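(* Let $d$ be a positive rational number and let $m$, $n$ and $p$ be integers such that $mn>1$ and $p^{2}d\mid n$ (that is, $n/(p^{2}d)$ is an integer). Then the following hold, where $\phi$ is the function defined in the context. (1) If $m>1$, $n/(p^{2}d)>1$ and $p>1$, then $$\left [1; \overline{p-1,1, \frac{n^{k}}{p^{2}d}-1,p-1,1, m^{k}-1} \, \right ]_{k=1}^{\infty}=\frac{1}{p}+\frac{\phi(d m,d,1/(m n))}{\phi(d/n,d,1/(m n))}.$$ (2) If $m>1$, $n/(p^{2}d)>1$ and $p>2$, then $$\left [1; \overline{p, \frac{n^{k}}{p^{2}d}-1,1,p-2,1, m^{k}-1} \, \right ]_{k=1}^{\infty}=\frac{1}{p}+\frac{\phi(-d m,-d,1/(m n))}{\phi(-d/n,-d,1/(m n))}.$$ (3) If $m>1$, $n/(p^{2}d)>1$ and $p>1$, then $$\left [0; \overline{1,p-1, \frac{n^{k}}{p^{2}d}-1,1,p-1, m^{k}-1} \, \right ]_{k=1}^{\infty}=\frac{-1}{p}+\frac{\phi(d m,d,1/(m n))}{\phi(d/n,d,1/(m n))}.$$ (4) If $m>1$, $n/(p^{2}d)>1$ and $p>2$, then $$\left [1; \overline{p-1,1, \frac{n^{2k-1}}{p^{2}d}-1,p, m^{2k-1}-1,1,p-2,1, \frac{n^{2k}}{p^{2}d}-1,p-1,1, m^{2k}-1} \, \right ]_{k=1}^{\infty}=\frac{1}{p}+\frac{\phi(-d m,d,-1/(m n))}{\phi(d/n,d,-1/(m n))}.$$ (5) If $m>1$, $n/(p^{2}d)>1$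 and $p>2$, then $$\left [1; \overline{p,\frac{n^{2k-1}}{p^{2}d}-1,1,p-2,1, m^{2k-1}-1,p-1,1, \frac{n^{2k}}{p^{2}d}-1,p-1,1, m^{2k}-1} \, \right ]_{k=1}^{\infty}=\frac{1}{p}+\frac{\phi(d m,d,-1/(m n))}{\phi(-d/n,d,-1/(m n))}.$$
   Context: For $r,s,q\in\mathbb{C}$ with $|q|<1$, define $$\phi(r,s,q)= \sum_{j=0}^{\infty}\frac{q^{(j^{2}+j)/2}r^{j}}{(q;q)_{j}(-sq;q)_{j}},$$ where $(x;q)_0:=1$ and $(x;q)_j:=\prod_{i=0}^{j-1}(1-xq^{i})$ for $j\ge 1$. $[a_0;a_1,a_2,\ldots]$ denotes the (value of the) infinite regular continued fraction $a_0+\cfrac{1}{a_1+\cfrac{1}{a_2+\cdots}}$. The notation $[a_0;\overline{f_1(k),\ldots,f_r(k)}\,]_{k=1}^{\infty}$ means that after $a_0$ the partial quotients are $f_1(1),\ldots,f_r(1),f_1(2),\ldots,f_r(2),f_1(3),\ldots$, i.e. the blocks $f_1(k),\ldots,f_r(k)$ for $k=1,2,3,\ldots$ concatenated in order. *)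

(* Defs.v *)
From HB Require Import structures.
From mathcomp Require Export all_boot all_order all_algebra.
From mathcomp Require Export all_classical all_reals all_analysis.
From mathcomp Require Export complex.

Set Implicit Arguments.
Unset Strict Implicit.
Unset Printing Implicit Defensive.

Export Order.TTheory GRing.Theory Num.Theory.
Export numFieldNormedType.Exports.

Local Open Scope classical_set_scope.
Local Open Scope ring_scope.

Definition qpoch (C : pzRingType) (x q : C) (j : nat) : C :=
  \prod_(i < j) (1 - x * q ^+ i).

Definition phi_term (C : fieldType) (r s q : C) (j : nat) : C :=
  q ^+ ((j ^ 2 + j) %/ 2)%N * r ^+ j / (qpoch q q j * qpoch (- s * q) q j).

(* Meaningful for `|q| < 1 when no factor 1 + s * q ^+ i.+1 vanishes.  C is
   intended to be R[i] with R : realType; a generic numFieldType is used because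
   its norm topology is inferred canonically. *)
Definition phi (C : numFieldType) (r s q : C) : C :=
  limn (series (phi_term r s q)).

(* cf_tail a i n = a i + 1 / (a i.+1 + ... + 1 / a (i + n)) *)
Fixpoint cf_tail (F : fieldType) (a : nat -> F) (i n : nat) : F :=
  if n is n'.+1 then a i + (cf_tail a i.+1 n')^-1 else a i.

Definition convergent (F : fieldType) (a : nat -> F) (n : nat) : F :=
  cf_tail a 0 n.

(* The partial quotients are typed in rat because expressions such as
   n ^ k / (p ^ 2 * d) - 1 are only integers by virtue of hypotheses. *)
Definition regular_cf (a : nat -> rat) : Prop :=
  (forall i, a i \is a Num.int) /\ (forall i, 1 <= a i.+1).

(* z is the value [a 0; a 1, a 2, ...]; regularity and convergence are part of
   the assertion. *)
Definition regular_cf_value (C : numFieldType) (a : nat -> rat) (z : C) : Prop :=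
  regular_cf a /\ (fun n => ratr (convergent a n) : C) @ \oo --> z.

(* The sequence a0, f 1, f 2, ... in which the blocks f k are concatenated;
   every block must be nonempty, so that the first i of them reach index i. *)
Definition cf_blocks (a0 : rat) (f : nat -> seq rat) (i : nat) : rat :=
  nth 0 (a0 :: flatten [seq f k | k <- iota 1 i]) i.

(* Main.v *)
Require Import Defs.
From mathcomp Require Import ring lra zify.

(** Write [q = 1 / (m n)].  Comparing series term by term gives two contiguous
    relations for phi, [phi_contiguous_r] and [phi_contiguous_s]; alternating
    them unfolds the quotient of the theorem into
    [1 + 1/(n/d + 1/(m + 1/(n^2/d + 1/(m^2 + ...))))]
    ([phi_ratio_cf]).  All five right-hand sides are instances of this quotient,
    up to the summand [1/p] or [-1/p], under a change of sign: of [d] in the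
    second case, of [m] in the fourth, of [n] in the fifth.

    This is not yet a regular continued fraction, because [n^k / d] need not be
    an integer and signs may be negative.  Every other tail of it is
    [v_k = n^(k+1)/d + 1/(m^(k+1) + 1/v_(k+1))].  The identity
    [1/p + 1/v = 1/(p - 1/((v + p)/p^2))] turns [n^k / d] into
    [n^k / (p^2 d)], and the identity [x - 1/y = [x - 1; 1, y - 1]]
    ([cf_singular]) turns the minus signs which this produces into partial
    quotients equal to 1.  Concretely, each block of the theorem maps the number
    [1 / (1/p + 1/v_(k+1))] to [1 / (1/p + 1/v_k)]; here [1/p + 1/v] is
    [1 - 1/p + 1/v] in the third case, and the blocks of the last two cases are
    composed of two such maps, passing through [1 - 1/p - 1/v] in the fourth.
    These are the lemmas [cf_block_pos] to [cf_block_after_neg].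

    So the numbers just named satisfy the recurrence of the tails of the regular
    continued fraction.  They are positive, because the hypotheses force
    [`|v_k| > p], and a regular continued fraction with positive tails converges
    to the number from which the tails were computed ([cf_blocks_value]).  All of
    this takes place over the reals; the values are carried to the complex
    numbers at the end. *)

Set Implicit Arguments.
Unset Strict Implicit.
Unset Printing Implicit Defensive.

Local Open Scope ring_scope.

(** * Continued fractions with prescribed tails *)

Section ContinuedFraction.
Local Open Scope classical_set_scope.
Variable R : realType.
Implicit Types (a : nat -> rat) (s : seq rat) (X : nat -> R).

Lemma cf_tail_ge1 a i n : (forall j, 1 <= a j.+1) -> 1 <= cf_tail a i.+1 n.
Proof.
move=> a_ge1; elim: n i => [|n IHn] i //=.
by rewrite -[1]addr0 lerD // invr_ge0 (le_trans ler01 (IHn _)).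
Qed.

Lemma ratr_ge1 (x : rat) : 1 <= x -> 1 <= ratr x :> R.
Proof. by rewrite -(ler_rat R) rmorph1. Qed.

(** Passing from index [j + 1] to [j] divides the error by [X j.+1] times the
    shifted convergent.  Two consecutive complete quotients have product
    [a * X' + 1 >= 2], so the error halves every two steps; the weaker bound
    [2 / (n + 2)] already survives that induction and avoids parities. *)
Lemma cf_tail_dist a X i n :
  (forall j, 1 <= a j.+1) -> (forall j, 0 < X j.+1) ->
  (forall j, X j = ratr (a j) + (X j.+1)^-1) ->
  `|X i - ratr (cf_tail a i n)| <= 2 / n.+2%:R.
Proof.
move=> a_ge1 X_gt0 XE.
have X_ge1 j : 1 <= X j.+1.
  by rewrite XE -[1]addr0 lerD ?ratr_ge1 // invr_ge0 ltW.
have XX_ge2 j : 2 <= X j.+1 * X j.+2.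
  rewrite [X j.+1]XE mulrDl mulVf ?gt_eqF //.
  have := ratr_ge1 (a_ge1 j); have := X_ge1 j.+1; nra.
have step j k : X j - ratr (cf_tail a j k.+1) =
    (ratr (cf_tail a j.+1 k) - X j.+1) / (X j.+1 * ratr (cf_tail a j.+1 k)).
  have C_neq0 : ratr (cf_tail a j.+1 k) != 0 :> R.
    by rewrite gt_eqF // (lt_le_trans ltr01) // ratr_ge1 // cf_tail_ge1.
  have X_neq0 : X j.+1 != 0 by rewrite gt_eqF.
  by rewrite XE /= rmorphD fmorphV /=; field; apply/andP; split.
have bound j k (e : R) : `|X j.+1 - ratr (cf_tail a j.+1 k)| <= e ->
    `|X j - ratr (cf_tail a j k.+1)| <= e / X j.+1.
  move=> le_e.
  have C_ge1 := ratr_ge1 (cf_tail_ge1 j k a_ge1).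
  have XC0 : 0 < X j.+1 * ratr (cf_tail a j.+1 k).
    by rewrite mulr_gt0 // (lt_le_trans ltr01).
  rewrite step normf_div distrC [X in _ / X]gtr0_norm //.
  apply: ler_pM => //; first by rewrite invr_ge0 ltW.
  by rewrite lef_pV2 ?posrE // ler_peMr // ltW.
have base j : `|X j - ratr (cf_tail a j 0)| <= (X j.+1)^-1.
  by rewrite XE /= addrC addKr ger0_norm // invr_ge0 ltW.
have [m] := ubnP n; elim: m i n => // m IHm i [|[|n]] lt_nm.
- by rewrite divff ?pnatr_eq0 // (le_trans (base i)) // invf_le1.
- apply: (le_trans (bound _ _ _ (base i.+1))).
  rewrite -invfM.
  have half_le : (2:R)^-1 <= 2 / 3%:R by lra.
  apply: le_trans half_le; rewrite lef_pV2 ?posrE ?mulr_gt0 //.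
  by rewrite mulrC.
- have := IHm i.+2 n; rewrite ltnW // => /(_ isT) /bound /bound h.
  apply: (le_trans h).
  rewrite -mulrA -invfM -mulrA -invfM.
  have h2 : 0 < n.+2%:R :> R by rewrite ltr0n.
  rewrite ler_pM2l // lef_pV2 ?posrE ?mulr_gt0 //.
  have := XX_ge2 i; rewrite [n.+4%:R]mulrSr [n.+3%:R]mulrSr [X _ * _]mulrC.
  have : 2 <= n.+2%:R :> R by rewrite ler_nat.
  nra.
Qed.

(** Positive complete quotients determine the value: nothing is assumed about
    where [X] comes from, so any closed form of the tails can be used. *)
Lemma cvg_convergent a X :
  (forall j, 1 <= a j.+1) -> (forall j, 0 < X j.+1) ->
  (forall j, X j = ratr (a j) + (X j.+1)^-1) ->
  (fun n => ratr (convergent a n) : R) @ \oo --> X 0%N.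
Proof.
move=> a_ge1 X_gt0 XE.
apply/cvgrPdist_le => e e_gt0.
have e2_gt0 : 0 < e / 2 by rewrite divr_gt0.
have /cvgrPdist_le /(_ _ e2_gt0) := @cvg_harmonic R.
apply: filterS => n; rewrite sub0r normrN ger0_norm ?harmonic_ge0 // => h.
apply: le_trans (cf_tail_dist 0 n a_ge1 X_gt0 XE) _.
rewrite mulrC -ler_pdivlMr // (le_trans _ h) // /harmonic lef_pV2 ?posrE ?ltr0n //.
by rewrite ler_nat.
Qed.

(** A list of partial quotients acting on a tail [z] as a Moebius map; unlike
    [cf_tail], the last tail is an arbitrary real. *)
Fixpoint cf_fold s (z : R) : R :=
  if s is b :: s' then ratr b + (cf_fold s' z)^-1 else z.

Lemma cf_fold_cat s t z : cf_fold (s ++ t) z = cf_fold s (cf_fold t z).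
Proof. by elim: s => //= b s ->. Qed.

Lemma cf_fold_gt0 s z : all (fun b => 1 <= b) s -> 0 < z -> 0 < cf_fold s z.
Proof.
move=> + z_gt0; elim: s => //= b s IHs /andP[b_ge1 /IHs s_gt0].
by rewrite addr_gt0 ?invr_gt0 // (lt_le_trans ltr01) // ratr_ge1.
Qed.

(** It is enough to know the tails [zeta k] at the block boundaries: a tail
    inside a block is a [cf_fold] of the rest of that block, positive because
    the partial quotients are at least 1. *)
Lemma cf_blocks_value (a0 : rat) (f : nat -> seq rat) (zeta : nat -> R) :
    a0 \is a Num.int ->
    (forall k, 0 < size (f k.+1))%N ->
    (forall k, all (fun b => (b \is a Num.int) && (1 <= b)) (f k.+1)) ->
    (forall k, 0 < zeta k) ->
    (forall k, zeta k = cf_fold (f k.+1) (zeta k.+1)) ->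
  regular_cf_value (cf_blocks a0 f) (ratr a0 + (zeta 0)^-1).
Proof.
move=> a0_int f_size f_all zeta_gt0 zetaE.
pose l i := flatten [seq f k | k <- iota 1 i].
have lS i : l i.+1 = l i ++ f i.+1.
  by rewrite /l -[i.+1]addn1 iotaD map_cat flatten_cat /= cats0 add1n addn1.
have l_size i : (i <= size (l i))%N.
  by elim: i => // i IHi; rewrite lS size_cat -[X in (X <= _)%N]addn1 leq_add.
have l_all i : all (fun b => (b \is a Num.int) && (1 <= b)) (l i).
  by elim: i => // i IHi; rewrite lS all_cat IHi f_all.
have aE i : cf_blocks a0 f i.+1 = nth 0 (l i.+1) i by [].
have a_all i : (cf_blocks a0 f i.+1 \is a Num.int) && (1 <= cf_blocks a0 f i.+1).
  by rewrite aE; apply: (all_nthP 0 (l_all i.+1)); exact: l_size.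
have a_ge1 i : 1 <= cf_blocks a0 f i.+1 by have /andP[] := a_all i.
split; first by split=> // -[//|i]; have /andP[] := a_all i.
(* The tail at index i: what is left, from index i on, of the first i blocks,
   followed by the tail after those blocks.  Appending one more block does not
   change it, which gives the recurrence. *)
pose X i := cf_fold (drop i (a0 :: l i)) (zeta i).
have drop_start i : drop i (a0 :: l i.+1) = cf_blocks a0 f i :: drop i (l i.+1).
  have lt_i : (i < size (a0 :: l i.+1))%N by rewrite /= ltnS (leq_trans _ (l_size _)).
  rewrite (drop_nth 0 lt_i); congr (_ :: _).
  rewrite /cf_blocks -/(l i) lS -cat_cons nth_cat /= ltnS l_size.
  by [].
have XE i : X i = ratr (cf_blocks a0 f i) + (X i.+1)^-1.
  rewrite {1}/X zetaE -cf_fold_cat.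
  have -> : drop i (a0 :: l i) ++ f i.+1 = drop i (a0 :: l i.+1).
    by rewrite lS -cat_cons drop_cat /= ltnS l_size.
  by rewrite drop_start.
have X_gt0 i : 0 < X i.+1.
  apply: cf_fold_gt0 => //=; apply/allP => b /mem_drop b_in.
  by have /allP /(_ b b_in) /andP[] := l_all i.+1.
have -> : ratr a0 + (zeta 0)^-1 = X 0%N by [].
exact: cvg_convergent.
Qed.
End ContinuedFraction.

(** * Contiguous relations of phi *)

Lemma phi_term0 (C : fieldType) (r s q : C) : phi_term r s q 0 = 1.
Proof. by rewrite /phi_term /qpoch !big_ord0 div0n !expr0 !mul1r invr1. Qed.

Lemma phi_termS (C : fieldType) (r s q : C) j :
  phi_term r s q j.+1 =
  phi_term r s q j * (r * q ^+ j.+1 / ((1 - q ^+ j.+1) * (1 + s * q ^+ j.+1))).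
Proof.
rewrite /phi_term /qpoch !big_ord_recr /=.
have -> : ((j.+1 ^ 2 + j.+1) %/ 2 = (j ^ 2 + j) %/ 2 + j.+1)%N.
  have -> : (j.+1 ^ 2 + j.+1 = j.+1 * 2 + (j ^ 2 + j))%N by rewrite !expnS !expn0; lia.
  by rewrite divnMDl // addnC.
rewrite exprD [q ^+ j.+1]exprS [r ^+ j.+1]exprS !invfM.
rewrite !mulNr !opprK -![s * q * _]mulrA.
ring.
Qed.

Lemma phi_term_scale (C : fieldType) (r s q : C) j :
  phi_term (r * q) s q j = q ^+ j * phi_term r s q j.
Proof.
elim: j => [|j IHj]; first by rewrite !phi_term0 mulr1.
by rewrite !phi_termS IHj (exprS q j); ring.
Qed.

Section SmallArguments.
Local Open Scope classical_set_scope.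
Variable R : realType.
Implicit Types r s q : R.

(** Under these bounds the ratio of consecutive terms of the series of phi is at
    most [(1/8) / ((1/2) * (15/16)) = 4/15 < 1/3].  Both the convergence and the
    positivity of phi follow from comparison with a geometric series of ratio
    [1/3], and the bounds persist when [r] or [s] is multiplied by [q]. *)
Definition small_args r s q :=
  [/\ `|q| <= 2^-1, `|r * q| <= 8^-1 & `|s * q| <= 16^-1].

Lemma small_scale r s q : small_args r s q -> small_args (r * q) s q.
Proof.
move=> [hq hr hs]; split=> //.
rewrite normrM (le_trans _ hr) // ler_piMr // (le_trans hq) //; lra.
Qed.

Lemma small_scale_s r s q : small_args r s q -> small_args r (s * q) q.
Proof.
move=> [hq hr hs]; split=> //.
rewrite normrM (le_trans _ hs) // ler_piMr // (le_trans hq) //; lra.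
Qed.

Lemma small_expr q j : `|q| <= 2^-1 -> `|q ^+ j| <= 1.
Proof. by move=> hq; rewrite normrX exprn_ile1 // (le_trans hq) //; lra. Qed.

Lemma small_sq r s q j : small_args r s q -> `|s * q ^+ j.+1| <= 16^-1.
Proof.
move=> [hq _ hs]; rewrite exprS mulrA normrM (le_trans _ hs) // ler_piMr //.
exact: small_expr.
Qed.

Lemma small_den_ge r s q j : small_args r s q ->
  2^-1 <= 1 - q ^+ j.+1 /\ 15 / 16 <= 1 + s * q ^+ j.+1.
Proof.
move=> sm; have := small_sq j sm; case: sm => hq _ _.
have : `|q ^+ j.+1| <= 2^-1.
  by rewrite exprS normrM (le_trans _ hq) // ler_piMr // small_expr.
by rewrite !ler_norml; move=> /andP[? ?] /andP[? ?]; split; lra.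
Qed.

Lemma small_den_neq0 r s q j : small_args r s q ->
  (1 - q ^+ j.+1 != 0) /\ (1 + s * q ^+ j.+1 != 0).
Proof.
by move=> /(small_den_ge j)[h1 h2]; split; rewrite gt_eqF //; lra.
Qed.

(** Replacing [s] by [s * q] shifts the second Pochhammer symbol by one factor,
    so only its first and last factors change. *)
Lemma phi_term_shift r s q j : small_args r s q ->
  (1 + s * q) * phi_term r s q j = (1 + s * q ^+ j.+1) * phi_term r (s * q) q j.
Proof.
move=> sm; elim: j => [|j IHj]; first by rewrite !phi_term0 expr1.
rewrite !phi_termS [LHS]mulrA IHj.
have [h1 h2] := small_den_neq0 j sm; have [_ h3] := small_den_neq0 j.+1 sm.
move: h3; rewrite [q ^+ j.+2]exprS mulrA => h3.
by field; rewrite h1 h2 h3.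
Qed.

Lemma phi_term_le r s q j : small_args r s q -> `|phi_term r s q j| <= 3^-1 ^+ j.
Proof.
move=> sm; elim: j => [|j IHj]; first by rewrite phi_term0 normr1.
rewrite phi_termS normrM [3^-1 ^+ _]exprSr; apply: ler_pM => //.
have [h1 h2] := small_den_ge j sm.
have [hq hr _] := sm.
rewrite normf_div ler_pdivrMr; last first.
  by rewrite normr_gt0 mulf_neq0 // gt_eqF //; lra.
have -> : `|(1 - q ^+ j.+1) * (1 + s * q ^+ j.+1)| =
   (1 - q ^+ j.+1) * (1 + s * q ^+ j.+1).
  by rewrite ger0_norm // mulr_ge0 //; lra.
have : `|r * q ^+ j.+1| <= 8^-1.
  by rewrite exprS mulrA normrM (le_trans _ hr) // ler_piMr // small_expr.
move/le_trans; apply.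
have : 15 / 32 <= (1 - q ^+ j.+1) * (1 + s * q ^+ j.+1) by nra.
lra.
Qed.

Lemma is_cvg_phi r s q : small_args r s q -> cvgn (series (phi_term r s q)).
Proof.
move=> sm; apply: normed_cvg.
apply: (@series_le_cvg _ _ (fun j => 3^-1 ^+ j)) => [j|j|j|] /=.
- by [].
- by rewrite exprn_ge0 // invr_ge0.
- exact: phi_term_le.
- have -> : (fun j => 3^-1 ^+ j) = geometric 1 (3^-1 : R).
    by apply/funext => j /=; rewrite mul1r.
  by apply: is_cvg_geometric_series; rewrite ger0_norm ?invr_ge0 //; lra.
Qed.

(** The constant is [1/3 + 1/9 + ... = 1/2]; in particular phi is positive. *)
Lemma phi_dist1 r s q : small_args r s q -> `|phi r s q - 1| <= 2^-1.
Proof.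
move=> sm.
suff h n : `|series (phi_term r s q) n.+1 - 1| <= 2^-1.
  have c : (fun n => `|series (phi_term r s q) n.+1 - 1|) @ \oo --> `|phi r s q - 1|.
    apply: cvg_norm; apply: cvgB; last exact: cvg_cst.
    by rewrite (cvg_shiftS (series _)); exact: is_cvg_phi.
  rewrite -(cvg_lim _ c) //; apply: limr_le; first by apply/cvg_ex; eexists; exact: c.
  by apply: nearW => n; exact: h.
have -> : series (phi_term r s q) n.+1 - 1 = \sum_(i < n) phi_term r s q i.+1.
  by rewrite /series /= big_mkord big_ord_recl phi_term0 addrC addKr.
apply: (le_trans (ler_norm_sum _ _ _)).
have -> : 2^-1 = 2^-1 * (1 - 3^-1 ^+ n) + 2^-1 * 3^-1 ^+ n :> R by ring.
apply: ler_wpDr; first by rewrite mulr_ge0 ?exprn_ge0 ?invr_ge0.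
elim: n => [|n IHn]; first by rewrite big_ord0 expr0 subrr mulr0.
rewrite big_ord_recr /=; have := phi_term_le n.+1 sm.
rewrite exprS; set x := 3^-1 ^+ n in IHn *.
have : 0 <= x by rewrite exprn_ge0 ?invr_ge0.
lra.
Qed.

Lemma series_cvg r s q : small_args r s q ->
  series (phi_term r s q) @ \oo --> phi r s q.
Proof. exact: is_cvg_phi. Qed.

(** Termwise, [t_j(r) - t_j(r q) = (1 - q^j) t_j(r)]; the factor [1 - q^j]
    cancels against the last factor of the first Pochhammer symbol and leaves,
    after a shift of the index, a series of the same type. *)
Lemma phi_contiguous_r r s q : small_args r s q ->
  phi r s q = phi (r * q) s q + r * q / (1 + s * q) * phi (r * q) (s * q) q.
Proof.
move=> sm; have sm1 := small_scale sm; have sm2 := small_scale_s sm1.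
have [_ h] := small_den_neq0 0 sm; rewrite expr1 in h.
set c := r * q / (1 + s * q).
have stepE j : phi_term r s q j.+1 = phi_term (r * q) s q j.+1 +
    c * phi_term (r * q) (s * q) q j.
  have [h1 h2] := small_den_neq0 j sm.
  have := phi_term_shift j sm.
  rewrite !phi_term_scale !phi_termS /c => /(canRL (mulKf h)) ->.
  move: h1 h2; rewrite exprS => h1 h2.
  by field; rewrite h h1 h2.
have cl : (fun n => series (phi_term r s q) n.+1) @ \oo --> phi r s q.
  by rewrite (cvg_shiftS (series _)); exact: series_cvg.
apply: (cvg_unique _ cl) => //.
have -> : (fun n => series (phi_term r s q) n.+1) =
    (fun n => series (phi_term (r * q) s q) n.+1 +
              c * series (phi_term (r * q) (s * q) q) n).
  apply/funext => n; elim: n => [|n IHn].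
    by rewrite /series /= !big_nat1 big_geq // !phi_term0 mulr0 addr0.
  move: IHn; rewrite /series /= => IHn.
  rewrite big_nat_recr //= IHn stepE [in RHS]big_nat_recr //=.
  by rewrite [X in _ = _ + c * X]big_nat_recr //=; ring.
apply: cvgD; first by rewrite (cvg_shiftS (series _)); exact: series_cvg.
by apply: cvgMl_tmp; exact: series_cvg.
Qed.

(** [phi_term_shift] summed over [j]: the factor [1 + s q^(j+1)] splits the right
    side into the series at [r] and, by [phi_term_scale], the series at [r q]. *)
Lemma phi_contiguous_s r s q : small_args r s q ->
  (1 + s * q) * phi r s q = phi r (s * q) q + s * q * phi (r * q) (s * q) q.
Proof.
move=> sm; have sm1 := small_scale_s sm; have sm2 := small_scale sm1.
have cl : (fun n => (1 + s * q) * series (phi_term r s q) n) @ \oo -->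
    (1 + s * q) * phi r s q by apply: cvgMl_tmp; exact: series_cvg.
apply: (cvg_unique _ cl) => //.
have -> : (fun n => (1 + s * q) * series (phi_term r s q) n) =
    (fun n => series (phi_term r (s * q) q) n +
              s * q * series (phi_term (r * q) (s * q) q) n).
  apply/funext => n; rewrite /series /= !big_distrr /= -big_split /=.
  apply: eq_bigr => j _; rewrite phi_term_shift // phi_term_scale exprS; ring.
by apply: cvgD; [|apply: cvgMl_tmp]; exact: series_cvg.
Qed.
End SmallArguments.

(** * The quotient of two values of phi as a continued fraction *)

Section Ratio.
Variables (R : realType) (M N D : R).
Hypotheses (D_neq0 : D != 0) (M_ge2 : 2 <= `|M|) (N_ge1 : 1 <= `|N|).
Hypothesis DN : 8 * `|D| <= `|N|.
Let q := (M * N)^-1.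

Let M_neq0 : M != 0. Proof. by rewrite -normr_gt0 (lt_le_trans _ M_ge2). Qed.
Let N_neq0 : N != 0. Proof. by rewrite -normr_gt0 (lt_le_trans _ N_ge1). Qed.

Let small_k k : small_args (D * M * q ^+ k) (D * q ^+ k) q.
Proof.
have sm : small_args (D * M) D q.
  have [N_gt0 M_gt0] : 0 < `|N| /\ 0 < `|M| by rewrite !normr_gt0.
  move: M_ge2 N_ge1 DN => hM hN hD.
  split; rewrite /q.
  - rewrite normfV normrM lef_pV2 ?posrE ?mulr_gt0 //; nra.
  - have -> : D * M * (M * N)^-1 = D / N by field; rewrite M_neq0 N_neq0.
    by rewrite normf_div ler_pdivrMr //; lra.
  - by rewrite normf_div normrM ler_pdivrMr ?mulr_gt0 //; nra.
elim: k => [|k IHk]; first by rewrite expr0 !mulr1.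
by rewrite exprSr !mulrA; apply: small_scale; apply: small_scale_s.
Qed.

Let small_k1 k : small_args (D * M * q ^+ k.+1) (D * q ^+ k) q.
Proof. by rewrite exprSr mulrA; exact: small_scale. Qed.

(** Let [F k] and [G k] be the values of phi at [(D M q^k, D q^k)] and at
    [(D M q^(k+1), D q^k)].  The numbers [w k = M^k F k / G k] unfold
    [F 0 / G 0 = 1 + 1/(N/D + 1/(M + 1/(N^2/D + 1/(M^2 + ...))))].  The two
    contiguous relations, applied at [D M q^k] and at [D M q^(k+1)], express
    [F k] and [G k] through [F k.+1] and [G k.+1]; eliminating gives the
    recurrence, since [q^(k+1) = 1 / (M N)^(k+1)].  All values of phi involved
    lie in [[1/2, 3/2]], whence the bound [3 = (3/2) / (1/2)] on [G / F], and
    [3/2] after division by [`|M| >= 2]. *)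
Lemma phi_ratio_cf : exists w : nat -> R,
  [/\ w 0%N = phi (D * M) D q / phi (D / N) D q,
      forall k, w k = M ^+ k + (N ^+ k.+1 / D + (w k.+1)^-1)^-1
    & forall k, `|(w k.+1)^-1| <= 3 / 2].
Proof.
pose F k := phi (D * M * q ^+ k) (D * q ^+ k) q.
pose G k := phi (D * M * q ^+ k.+1) (D * q ^+ k) q.
have Fb k : 2^-1 <= F k <= 3 / 2.
  have := phi_dist1 (small_k k); rewrite -/(F k) ler_norml => /andP[? ?].
  by apply/andP; split; lra.
have Gb k : 2^-1 <= G k <= 3 / 2.
  have := phi_dist1 (small_k1 k); rewrite -/(G k) ler_norml => /andP[? ?].
  by apply/andP; split; lra.
have F_gt0 k : 0 < F k by have /andP[? _] := Fb k; lra.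
have G_gt0 k : 0 < G k by have /andP[? _] := Gb k; lra.
have MX_neq0 k : M ^+ k != 0 by rewrite expf_neq0.
have NXE k : N ^+ k.+1 = (M * M ^+ k * q ^+ k.+1)^-1.
  by rewrite /q exprVn exprMn [M ^+ k.+1]exprS invfM invrK mulKf // mulf_neq0.
have q_neq0 : q != 0 by rewrite invr_neq0 // mulf_neq0.
exists (fun k => M ^+ k * F k / G k); split=> [|k|k].
- rewrite /F /G expr0 expr1 !mulr1 mul1r; congr (_ / phi _ _ _).
  by rewrite /q invfM; field; rewrite M_neq0 N_neq0.
- have := phi_contiguous_r (small_k k); have := phi_contiguous_s (small_k1 k).
  have [_ c_neq0] := small_den_neq0 0 (small_k k); rewrite expr1 in c_neq0.
  rewrite -![_ * q ^+ _ * q]mulrA -!exprSr -/(F _) -/(G _) -/(F _) -/(G _).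
  rewrite -[_ * q ^+ _ * q]mulrA -exprSr in c_neq0.
  have := F_gt0 k.+1; have := G_gt0 k.+1; have := G_gt0 k; have := F_gt0 k.
  move: (F k) (G k) (F k.+1) (G k.+1) => f g f1 g1 f0 g0 g10 f10 gE fE.
  have s_neq0 : f1 + D * q ^+ k.+1 * g1 != 0 by rewrite -gE mulf_neq0 // gt_eqF.
  have {gE}gE : g = (f1 + D * q ^+ k.+1 * g1) / (1 + D * q ^+ k.+1).
    by rewrite -gE mulrC mulKf.
  have Q_neq0 : q ^+ k.+1 != 0 by rewrite expf_neq0.
  have M0 := M_neq0; have a0 := MX_neq0 k; have D0 := D_neq0.
  (* N is eliminated in favour of q, so that [field] sees only the two
     denominators of the contiguous relations. *)
  rewrite fE gE NXE [M ^+ k.+1]exprS.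
  move: (q ^+ k.+1) (M ^+ k) s_neq0 Q_neq0 c_neq0 a0 => Q a s0 Q0 c0 a0.
  field; rewrite a0 M0 D0 Q0 c0 (gt_eqF g10) (gt_eqF f10) /= andbT.
  by have -> : f1 + g1 * (Q * D) = f1 + D * Q * g1 by ring.
- have /andP[G1 G2] := Gb k.+1; have /andP[F1 F2] := Fb k.+1.
  rewrite invf_div normrM normfV [`|G _|]gtr0_norm // normrM [`|F _|]gtr0_norm //.
  have MX : 2 <= `|M ^+ k.+1|.
    rewrite normrX exprS -[2]mulr1; apply: ler_pM => //.
    by rewrite exprn_ege1 // (le_trans _ M_ge2) // ler1n.
  have := F_gt0 k.+1 => F0.
  rewrite ler_pdivrMr ?mulr_gt0 //; nra.
Qed.

Lemma cvg_phi_ratio : cvgn (series (phi_term (D * M) D q)) /\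
  cvgn (series (phi_term (D / N) D q)).
Proof.
have qN : q * M = N^-1 by rewrite /q invfM mulrAC mulVf ?mul1r.
split; apply: is_cvg_phi.
  by have := small_k 0; rewrite expr0 !mulr1.
by have := small_k1 0; rewrite expr0 expr1 mulr1 -mulrA [M * q]mulrC qN.
Qed.
End Ratio.

(** * Transfer from the reals to the complex numbers *)

Section RealToComplex.
Local Open Scope classical_set_scope.
Local Open Scope complex_scope.

(** Stated for an abstract field so that the norm topology is found; the
    instance for complex numbers then comes by unification. *)
Lemma cvgn_dist_lt (C : numFieldType) (u : nat -> C) (l : C) :
  (forall e, 0 < e -> \forall n \near \oo, `|l - u n| < e) -> u @ \oo --> l.
Proof. by move=> ul; apply/cvgrPdist_lt. Qed.

Lemma cvg_complex (R : realType) (u : nat -> R) (l : R) :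
  u @ \oo --> l -> (fun n => (u n)%:C) @ \oo --> (l%:C : (R[i] : numFieldType)).
Proof.
move=> /cvgrPdist_lt ul; apply: cvgn_dist_lt => e e_gt0.
have eE : e = (complex.Re e)%:C by rewrite RRe_real // gtr0_real.
have Re_gt0 : 0 < complex.Re e by rewrite -ltcR -eE.
have := ul _ Re_gt0; apply: filterS => n.
by rewrite eE -rmorphB normc_def /= expr0n addr0 sqrtr_sqr ltcR.
Qed.

Lemma phi_lim (C : numFieldType) (r s q l : C) :
  series (phi_term r s q) @ \oo --> l -> phi r s q = l.
Proof. by move=> cv; apply: cvg_lim => //; exact: norm_hausdorff. Qed.

Lemma rmorph_phi_term (F C : fieldType) (f : {rmorphism F -> C}) (r s q : F) j :
  phi_term (f r) (f s) (f q) j = f (phi_term r s q j).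
Proof.
have qpochE x : qpoch (f x) (f q) j = f (qpoch x q j).
  rewrite /qpoch rmorph_prod; apply: eq_bigr => i _.
  by rewrite rmorphB rmorph1 rmorphM rmorphXn.
by rewrite /phi_term -rmorphN -rmorphM !qpochE -!rmorphXn -!rmorphM fmorph_div.
Qed.

Lemma phi_complex (R : realType) (r s q : R) : cvgn (series (phi_term r s q)) ->
  phi (r%:C) (s%:C) (q%:C) = (phi r s q)%:C :> R[i].
Proof.
move=> /cvg_complex cv; apply: phi_lim.
rewrite (_ : series _ = (fun n => (series (phi_term r s q) n)%:C)) //.
apply/funext => n; rewrite /series /= rmorph_sum; apply: eq_bigr => j _.
exact: rmorph_phi_term.
Qed.

Lemma regular_cf_value_complex (R : realType) (a : nat -> rat) (x : R) :
  regular_cf_value a x -> regular_cf_value a (x%:C : R[i]).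
Proof.
move=> [rega /cvg_complex cv]; split=> //.
have -> // : (fun n => ratr (convergent a n) : R[i]) =
   (fun n => (ratr (convergent a n) : R)%:C).
by apply/funext => n; rewrite fmorph_rat.
Qed.

End RealToComplex.

(** * One block as a Moebius map *)

Section Blocks.
Variable R : realType.

(** This identity removes the partial quotients 1 from the blocks, at the price
    of minus signs. *)
Lemma cf_singular (x y : R) : y != 0 -> y != 1 ->
  x - 1 + (1 + (y - 1)^-1)^-1 = x - y^-1.
Proof. by move=> y0 y1; field; rewrite y0 subr_eq0. Qed.

Lemma ratr_ge2 (x : rat) : 2 <= x -> 2 <= ratr x :> R.
Proof. by rewrite -(ler_rat R) rmorph_nat. Qed.

(** For [u] the absolute value of [+-A + t], these bounds make every denominator
    met below nonzero. *)
Lemma block_bounds (P N u : R) : 2 <= P -> 2 <= N -> 3 / 2 <= u ->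
  [/\ 3 <= u * P, 6 <= P * (u * P) & 4 * (u * P) <= P ^+ 2 * N * u].
Proof.
move=> P2 N2 u2.
have uP : 3 <= u * P by nra.
have PN : 4 <= P * N by nra.
by split => //; nra.
Qed.

(** In this lemma and the next four [v = +-P^2 N + 1/(+-A + t)], so [t = 1/v'] where
    [v'] is the next [v]: the block carries a fixed function of [1/v'] to a
    fixed function of [1/v].  Here all signs are positive and
    [cf_singular] reads the block as
    [P - 1/(N + 1/(P - 1/(u + 1/P)))], where
    [1/(P - 1/(u + 1/P)) = 1/P + 1/(P^2 u)]. *)
Lemma cf_block_pos (P N A : rat) (t v : R) : 2 <= P -> 2 <= N -> 2 <= A ->
    `|t| <= 2^-1 -> v = ratr P ^+ 2 * ratr N + (ratr A + t)^-1 ->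
  cf_fold [:: P - 1; 1; N - 1; P - 1; 1; A - 1] ((ratr P)^-1 + t)^-1 =
  ((ratr P)^-1 + v^-1)^-1.
Proof.
rewrite /= !rmorphB /= !rmorph1 /= ler_norml.
move=> /ratr_ge2 + /ratr_ge2 + /ratr_ge2 + /andP[].
move: (ratr P) (ratr N) (ratr A) => {}P {}N {}A P2 N2 A2 t1 t2 vE.
have [u uE] : exists u, u = A + t by eexists.
rewrite -uE in vE.
have p_gt0 : 0 < P^-1 by rewrite invr_gt0; lra.
rewrite invrK (_ : A - 1 + (P^-1 + t) = (u + P^-1) - 1); last by rewrite uE; ring.
rewrite cf_singular ?gt_eqF; try lra.
rewrite [N - 1 + _]addrAC.
have z_gt0 : 0 < (P - (u + P^-1)^-1)^-1.
  rewrite invr_gt0 subr_gt0 invf_plt ?posrE; lra.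
rewrite cf_singular ?gt_eqF; try lra.
have [|h1 h2 h3] := block_bounds P2 N2 (u := u); first lra.
by rewrite vE; field; do ?[apply/andP; split]; apply/eqP; lra.
Qed.

(** The sign of [n^k / d] is changed; the block reads
    [P + 1/(N - 1/P - 1/(P^2 u))]. *)
Lemma cf_block_neg (P N A : rat) (t v : R) : 2 <= P -> 2 <= N -> 2 <= A ->
    `|t| <= 2^-1 -> v = - (ratr P ^+ 2 * ratr N) + (ratr A + t)^-1 ->
  cf_fold [:: P; N - 1; 1; P - 2; 1; A - 1] ((ratr P)^-1 + t)^-1 =
  ((ratr P)^-1 + v^-1)^-1.
Proof.
rewrite /= !rmorphB /= !rmorph1 /= ?rmorph_nat /= ler_norml.
move=> /ratr_ge2 + /ratr_ge2 + /ratr_ge2 + /andP[].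
move: (ratr P) (ratr N) (ratr A) => {}P {}N {}A P2 N2 A2 t1 t2 vE.
have [u uE] : exists u, u = A + t by eexists.
rewrite -uE in vE.
have p_gt0 : 0 < P^-1 by rewrite invr_gt0; lra.
rewrite invrK (_ : A - 1 + (P^-1 + t) = (u + P^-1) - 1); last by rewrite uE; ring.
rewrite (_ : P - 2 = (P - 1) - 1); last by ring.
rewrite cf_singular ?gt_eqF; try lra.
rewrite [P - 1 - _]addrAC.
have z_gt0 : (u + P^-1)^-1 < 1 by rewrite invf_plt ?posrE; lra.
rewrite cf_singular ?gt_eqF; try lra.
have [|h1 h2 h3] := block_bounds P2 N2 (u := u); first lra.
by rewrite vE; field; do ?[apply/andP; split]; apply/eqP; lra.
Qed.

(** The reciprocals of both tails are those of [cf_block_pos] moved by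
    [1 - 2/P]; this exchanges the entries [P - 1, 1] with [1, P - 1]. *)
Lemma cf_block_shifted (P N A : rat) (t v : R) : 2 <= P -> 2 <= N -> 2 <= A ->
    `|t| <= 2^-1 -> v = ratr P ^+ 2 * ratr N + (ratr A + t)^-1 ->
  cf_fold [:: 1; P - 1; N - 1; 1; P - 1; A - 1] (1 - (ratr P)^-1 + t)^-1 =
  (1 - (ratr P)^-1 + v^-1)^-1.
Proof.
rewrite /= !rmorphB /= !rmorph1 /= ler_norml.
move=> /ratr_ge2 + /ratr_ge2 + /ratr_ge2 + /andP[].
move: (ratr P) (ratr N) (ratr A) => {}P {}N {}A P2 N2 A2 t1 t2 vE.
have [u uE] : exists u, u = A + t by eexists.
rewrite -uE in vE.
have p_gt0 : 0 < P^-1 by rewrite invr_gt0; lra.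
have p_le : P^-1 <= 2^-1 by rewrite lef_pV2 ?posrE; lra.
rewrite invrK (_ : A - 1 + (1 - P^-1 + t) = u - P^-1); last by rewrite uE; ring.
rewrite [P - 1 + (u - P^-1)^-1]addrAC.
have z_gt0 : 0 < (u - P^-1)^-1 by rewrite invr_gt0; lra.
rewrite cf_singular ?gt_eqF; try lra.
have [|h1 h2 h3] := block_bounds P2 N2 (u := u); first lra.
rewrite vE; field; do ?[apply/andP; split]; apply/eqP; try nra.
Qed.

(** Here the power of [m] that ends the block is counted negatively, and the
    tail left is the one which [cf_block_after_neg] produces: the identity
    [A - 1/P - t = - (u + 1/P)] lets the minus sign of [u] be absorbed. *)
Lemma cf_block_before_neg (P N A : rat) (t v : R) : 2 <= P -> 2 <= N -> 2 <= A ->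
    `|t| <= 2^-1 -> v = ratr P ^+ 2 * ratr N + (- ratr A + t)^-1 ->
  cf_fold [:: P - 1; 1; N - 1; P; A - 1] (1 - (ratr P)^-1 - t)^-1 =
  ((ratr P)^-1 + v^-1)^-1.
Proof.
rewrite /= !rmorphB /= !rmorph1 /= ler_norml.
move=> /ratr_ge2 + /ratr_ge2 + /ratr_ge2 + /andP[].
move: (ratr P) (ratr N) (ratr A) => {}P {}N {}A P2 N2 A2 t1 t2 vE.
have [u uE] : exists u, u = - A + t by eexists.
rewrite -uE in vE.
have p_gt0 : 0 < P^-1 by rewrite invr_gt0; lra.
rewrite invrK (_ : A - 1 + (1 - P^-1 - t) = - u - P^-1); last by rewrite uE; ring.
have p_le : P^-1 <= 2^-1 by rewrite lef_pV2 ?posrE; lra.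
have z_gt0 : 0 < (P + (- u - P^-1)^-1)^-1.
  by rewrite invr_gt0 addr_gt0 ?invr_gt0; lra.
rewrite [N - 1 + _]addrAC.
rewrite cf_singular ?gt_eqF; try lra.
have [|h1 h2 h3] := block_bounds P2 N2 (u := - u); first lra.
rewrite vE; field; do ?[apply/andP; split]; apply/eqP; try nra.
Qed.

(** The block that restores, after a negative power of [m], the tail
    [1 / (1/P + t)] from which [cf_block_before_neg] starts. *)
Lemma cf_block_after_neg (P N A : rat) (t v : R) : 2 <= P -> 2 <= N -> 2 <= A ->
    `|t| <= 2^-1 -> v = ratr P ^+ 2 * ratr N + (ratr A + t)^-1 ->
  cf_fold [:: 1; P - 2; 1; N - 1; P - 1; 1; A - 1] ((ratr P)^-1 + t)^-1 =
  (1 - (ratr P)^-1 - v^-1)^-1.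
Proof.
rewrite /= !rmorphB /= !rmorph1 /= ?rmorph_nat /= ler_norml.
move=> /ratr_ge2 + /ratr_ge2 + /ratr_ge2 + /andP[].
move: (ratr P) (ratr N) (ratr A) => {}P {}N {}A P2 N2 A2 t1 t2 vE.
have [u uE] : exists u, u = A + t by eexists.
rewrite -uE in vE.
have p_gt0 : 0 < P^-1 by rewrite invr_gt0; lra.
rewrite invrK (_ : A - 1 + (P^-1 + t) = (u + P^-1) - 1); last by rewrite uE; ring.
rewrite cf_singular ?gt_eqF; try lra.
rewrite [N - 1 + _]addrAC.
rewrite (_ : P - 2 = (P - 1) - 1); last by ring.
have z_gt0 : 0 < (P - (u + P^-1)^-1)^-1.
  rewrite invr_gt0 subr_gt0 invf_plt ?posrE; lra.
rewrite cf_singular ?gt_eqF; try lra.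
have [|h1 h2 h3] := block_bounds P2 N2 (u := u); first lra.
rewrite vE; field; do ?[apply/andP; split]; apply/eqP; try nra.
Qed.
End Blocks.

(** * The quotient with rational parameters *)

Section RationalParameters.
Variable R : realType.
Local Open Scope complex_scope.

(** The recurrence of [phi_ratio_cf] read at its odd places.  The size of
    [N / D] gives [`|v| >= 2 P^2 - 3/2 > P]; so [1/P + 1/v] and its variants are
    positive whatever the signs of [M], [N] and [D]. *)
Lemma phi_ratio_tails (P M N D : rat) :
    2 <= P -> D != 0 -> 2 <= `|M| -> 1 <= `|N| -> 2 * P ^+ 2 * `|D| <= `|N| ->
  exists v : nat -> R,
  [/\ phi (ratr (D * M)) (ratr D) (ratr (1 / (M * N))) /
        phi (ratr (D / N)) (ratr D) (ratr (1 / (M * N))) =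
        (1 + (v 0%N)^-1)%:C :> R[i],
      forall k, v k = ratr (N ^+ k.+1 / D) + (ratr (M ^+ k.+1) + (v k.+1)^-1)^-1
    & forall k, `|(v k)^-1| < (ratr P)^-1].
Proof.
move=> P2 D0 M2 N1 PDN.
pose cst (x : rat) := ratr x : R.
have D0' : cst D != 0 by rewrite fmorph_eq0.
have M2' : 2 <= `|cst M| by rewrite -ratr_norm ratr_ge2.
have N1' : 1 <= `|cst N| by rewrite -ratr_norm ratr_ge1.
have DN' : 8 * `|cst D| <= `|cst N|.
  rewrite -!ratr_norm -[8](ratr_nat R) -rmorphM ler_rat (le_trans _ PDN) //.
  by rewrite ler_wpM2r //; nra.
have [w [w0 wS w_bound]] := phi_ratio_cf D0' M2' N1' DN'.
have [cvF cvG] := cvg_phi_ratio M2' N1' DN'.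
pose v k := cst N ^+ k.+1 / cst D + (w k.+1)^-1.
exists v; split=> [|k|k].
- have ratrC x : ratr x = (cst x)%:C :> R[i] by rewrite /cst fmorph_rat.
  have DM : cst (D * M) = cst D * cst M by rewrite /cst rmorphM.
  have DdN : cst (D / N) = cst D / cst N by rewrite /cst fmorph_div.
  have qE : cst (1 / (M * N)) = (cst M * cst N)^-1.
    by rewrite /cst div1r fmorphV rmorphM.
  rewrite !ratrC DM DdN qE !phi_complex // -fmorph_div /= -w0 wS expr0.
  by [].
- by rewrite fmorph_div !rmorphXn -wS.
- have P2' : 2 <= cst P by exact: ratr_ge2.
  have P0' : 0 < cst P by lra.
  have y_ge : 2 * cst P ^+ 2 <= `|cst N ^+ k.+1 / cst D|.
    rewrite normf_div ler_pdivlMr ?normr_gt0 // normrX [`|_| ^+ _]exprSr.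
    have h : 2 * cst P ^+ 2 * `|cst D| <= `|cst N|.
      by rewrite -!ratr_norm -[2](ratr_nat R) -rmorphXn -!rmorphM ler_rat.
    by apply: (le_trans h); apply: ler_peMl => //; rewrite exprn_ege1.
  have v_gt : cst P < `|v k|.
    have := lerB_normD (cst N ^+ k.+1 / cst D) ((w k.+1)^-1).
    rewrite -/(v k); have := w_bound k; nra.
  by rewrite normfV ltf_pV2 ?posrE // (lt_trans _ v_gt).
Qed.

Definition partial_quotient (b : rat) := (b \is a Num.int) && (1 <= b).
Arguments partial_quotient : simpl never.

Lemma cf_blocks_value_complex (a0 : rat) (f : nat -> seq rat) (zeta : nat -> R)
    (z : R[i]) :
    a0 \is a Num.int ->
    (forall k, 0 < size (f k.+1))%N ->
    (forall k, all partial_quotient (f k.+1)) ->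
    (forall k, 0 < zeta k) ->
    (forall k, zeta k = cf_fold (f k.+1) (zeta k.+1)) ->
    z = (ratr a0 + (zeta 0)^-1)%:C ->
  regular_cf_value (cf_blocks a0 f) z.
Proof.
move=> *; subst z; apply: regular_cf_value_complex; exact: cf_blocks_value.
Qed.

End RationalParameters.

(** * The five continued fractions *)

Lemma tails_gt0 (R : realFieldType) (p x : R) : 2 <= p -> `|x| < p^-1 ->
  [/\ `|x| <= 2^-1, 0 < (p^-1 + x)^-1, 0 < (1 - p^-1 + x)^-1 &
    0 < (1 - p^-1 - x)^-1].
Proof.
move=> p2 xp.
have p_le : p^-1 <= 2^-1 by rewrite lef_pV2 ?posrE; lra.
rewrite !invr_gt0 (le_trans (ltW xp)) //.
by move: xp; rewrite ltr_norml => /andP[x1 x2]; split=> //; lra.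
Qed.

Lemma int_ge2 (x : rat) : x \is a Num.int -> 1 < x -> 2 <= x.
Proof. by move=> /intrP[z ->]; rewrite -[2]/(2%:~R) ltr1z ler_int. Qed.

Lemma inv_int_complex (R : realType) (p : int) :
  ((ratr p%:~R : R)^-1)%:C%C = (p%:~R)^-1 :> R[i].
Proof. by rewrite fmorphV ratr_int /= rmorph_int. Qed.

Lemma add_inv_int (R : realType) (p : int) (x : R) :
  1 / p%:~R + (1 + x)%:C%C = (ratr 1 + ((ratr p%:~R)^-1 + x))%:C%C :> R[i].
Proof.
by rewrite div1r -inv_int_complex -rmorphD rmorph1 addrCA.
Qed.

Lemma sub_inv_int (R : realType) (p : int) (x : R) :
  - 1 / p%:~R + (1 + x)%:C%C = (ratr 0 + (1 - (ratr p%:~R)^-1 + x))%:C%C :> R[i].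
Proof.
by rewrite mulN1r -inv_int_complex -rmorphN -rmorphD rmorph0 add0r addrA [- _ + 1]addrC.
Qed.

Lemma exprN_odd (x : rat) k : (- x) ^+ (2 * k).+1 = - x ^+ (2 * k).+1.
Proof. by rewrite exprNn -signr_odd /= oddM expr1 mulN1r. Qed.

Lemma exprN_even (x : rat) k : (- x) ^+ (2 * k).+2 = x ^+ (2 * k).+2.
Proof. by rewrite exprNn -signr_odd /= oddM mul1r. Qed.

Theorem theorem9 (R : realType) (d : rat) (m n p : int)
    (d_gt0 : 0 < d) (mn_gt1 : 1 < m * n)
    (p2d_dvd_n : n%:Q / (p%:Q ^+ 2 * d) \is a Num.int) :
  [/\ 1 < m -> 1 < n%:Q / (p%:Q ^+ 2 * d) -> 1 < p ->
      @regular_cf_value R[i]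
        (cf_blocks 1 (fun k => [::    p%:Q - 1; 1;
                                      n%:Q ^+ k / (p%:Q ^+ 2 * d) - 1;
                                      p%:Q - 1; 1; m%:Q ^+ k - 1]))
        (1 / p%:~R +
         phi (ratr (d * m%:Q)) (ratr d) (ratr (1 / (m%:Q * n%:Q))) /
         phi (ratr (d / n%:Q)) (ratr d) (ratr (1 / (m%:Q * n%:Q)))),
      1 < m -> 1 < n%:Q / (p%:Q ^+ 2 * d) -> 2 < p ->
      @regular_cf_value R[i]
        (cf_blocks 1 (fun k => [::    p%:Q;
                                      n%:Q ^+ k / (p%:Q ^+ 2 * d) - 1;
                                      1; p%:Q - 2; 1; m%:Q ^+ k - 1]))
        (1 / p%:~R +
         phi (ratr (- d * m%:Q)) (ratr (- d)) (ratr (1 / (m%:Q * n%:Q))) /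
         phi (ratr (- d / n%:Q)) (ratr (- d)) (ratr (1 / (m%:Q * n%:Q)))),
      1 < m -> 1 < n%:Q / (p%:Q ^+ 2 * d) -> 1 < p ->
      @regular_cf_value R[i]
        (cf_blocks 0 (fun k => [::    1; p%:Q - 1;
                                      n%:Q ^+ k / (p%:Q ^+ 2 * d) - 1;
                                      1; p%:Q - 1; m%:Q ^+ k - 1]))
        (- 1 / p%:~R +
         phi (ratr (d * m%:Q)) (ratr d) (ratr (1 / (m%:Q * n%:Q))) /
         phi (ratr (d / n%:Q)) (ratr d) (ratr (1 / (m%:Q * n%:Q)))),
      1 < m -> 1 < n%:Q / (p%:Q ^+ 2 * d) -> 2 < p ->
      @regular_cf_value R[i]
        (cf_blocks 1 (fun k => [::    p%:Q - 1; 1;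
                                      n%:Q ^+ (2 * k - 1) / (p%:Q ^+ 2 * d) - 1;
                                      p%:Q; m%:Q ^+ (2 * k - 1) - 1;
                                      1; p%:Q - 2; 1;
                                      n%:Q ^+ (2 * k) / (p%:Q ^+ 2 * d) - 1;
                                      p%:Q - 1; 1; m%:Q ^+ (2 * k) - 1]))
        (1 / p%:~R +
         phi (ratr (- d * m%:Q)) (ratr d) (ratr (- 1 / (m%:Q * n%:Q))) /
         phi (ratr (d / n%:Q)) (ratr d) (ratr (- 1 / (m%:Q * n%:Q)))) &
      1 < m -> 1 < n%:Q / (p%:Q ^+ 2 * d) -> 2 < p ->
      @regular_cf_value R[i]
        (cf_blocks 1 (fun k => [::    p%:Q;
                                      n%:Q ^+ (2 * k - 1) / (p%:Q ^+ 2 * d) - 1;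
                                      1; p%:Q - 2; 1;
                                      m%:Q ^+ (2 * k - 1) - 1; p%:Q - 1; 1;
                                      n%:Q ^+ (2 * k) / (p%:Q ^+ 2 * d) - 1;
                                      p%:Q - 1; 1; m%:Q ^+ (2 * k) - 1]))
        (1 / p%:~R +
         phi (ratr (d * m%:Q)) (ratr d) (ratr (- 1 / (m%:Q * n%:Q))) /
         phi (ratr (- d / n%:Q)) (ratr d) (ratr (- 1 / (m%:Q * n%:Q))))].
Proof.
set P := p%:Q; set n' := n%:Q; set m' := m%:Q.
set e := P ^+ 2 * d in p2d_dvd_n *.
have setup : 1 < m -> 1 < n' / e -> 1 < p ->
  [/\ 2 <= P, 2 <= m', 1 <= n' & 2 * P ^+ 2 * d <= n'].
  move=> m1 ne1 p1.
  have P2 : 2 <= P by apply: int_ge2; rewrite ?intr_int ?ltr1z.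
  have m2 : 2 <= m' by apply: int_ge2; rewrite ?intr_int ?ltr1z.
  have n1 : 0 < n by nia.
  have e0 : 0 < e by rewrite mulr_gt0 // exprn_gt0 // (lt_le_trans _ P2).
  split=> //; first by rewrite ler1z -gtz0_ge1.
  have := int_ge2 p2d_dvd_n ne1.
  by rewrite ler_pdivlMr // mulrA.
have pq_m k : 2 <= m' -> partial_quotient (m' ^+ k.+1 - 1).
  move=> m2; apply/andP; split; first by rewrite rpredB ?rpred1 ?rpredX ?intr_int.
  have : 1 <= m' ^+ k by rewrite exprn_ege1 //; lra.
  rewrite exprS; nra.
have ne_ge2 k : 1 <= n' -> 1 < n' / e -> 2 <= n' ^+ k.+1 / e.
  move=> n1 ne1; have := int_ge2 p2d_dvd_n ne1.
  have : 1 <= n' ^+ k by rewrite exprn_ege1.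
  rewrite exprSr -mulrA; nra.
have pq_n k : 1 <= n' -> 1 < n' / e -> partial_quotient (n' ^+ k.+1 / e - 1).
  move=> n1 ne1; apply/andP; split.
    by rewrite rpredB ?rpred1 // exprSr -mulrA rpredM // rpredX ?intr_int.
  by have := ne_ge2 k n1 ne1; lra.
have pq_p c : c \is a Num.int -> c + 1 <= P -> partial_quotient (P - c).
  by move=> c_int cP; apply/andP; split; [rewrite rpredB ?intr_int|lra].
have yE k : 2 <= P -> ratr (n' ^+ k / d) = ratr P ^+ 2 * ratr (n' ^+ k / e) :> R.
  move=> P2; have -> : n' ^+ k / d = P ^+ 2 * (n' ^+ k / e).
    by rewrite /e; field; rewrite !gt_eqF //; lra.
  by rewrite rmorphM rmorphXn.
have m_ge2 k : 2 <= m' -> 2 <= m' ^+ k.+1.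
  move=> m2; have : 1 <= m' ^+ k by rewrite exprn_ege1 //; lra.
  rewrite exprS; nra.
have d_neq0 : d != 0 by rewrite gt_eqF.
have d'_neq0 : - d != 0 by rewrite oppr_eq0.
have k_odd k : (2 * k.+1 - 1 = (2 * k).+1)%N by rewrite mulnS subn1.
have k_even k : (2 * k.+1 = (2 * k).+2)%N by rewrite mulnS.
have pq_P : 2 <= P -> partial_quotient P.
  by move=> P2; rewrite /partial_quotient intr_int /=; lra.
split=> m1 ne1 p1.
- have [P2 m2 n1 n_ge] := setup m1 ne1 p1.
  have [|||v [ratioE vS v_bound]] := @phi_ratio_tails R P m' n' d P2 d_neq0.
  1-3: by rewrite ?normrN !ger0_norm //; lra.
  have v_small k := tails_gt0 (ratr_ge2 R P2) (v_bound k).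
  apply: (@cf_blocks_value_complex _ _ _ (fun k => ((ratr P)^-1 + (v k)^-1)^-1)) => //.
  + by move=> k /=; rewrite ?pq_n ?pq_m ?pq_p ?pq_P //; lra.
  + by move=> k; have [] := v_small k.
  + move=> k; apply/esym; apply: cf_block_pos => //; rewrite ?ne_ge2 ?m_ge2 //.
      by have [] := v_small k.+1.
    by rewrite vS yE //.
  + by rewrite ratioE invrK add_inv_int.
- have [P2 m2 n1 n_ge] := setup m1 ne1 (lt_trans (ltr1n _ 2) p1).
  have P3 : 3 <= P by rewrite -[3]/(3%:~R) ler_int; lia.
  have [|||v [ratioE vS v_bound]] := @phi_ratio_tails R P m' n' (- d) P2 d'_neq0.
  1-3: by rewrite ?normrN !ger0_norm //; lra.
  have v_small k := tails_gt0 (ratr_ge2 R P2) (v_bound k).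
  apply: (@cf_blocks_value_complex _ _ _ (fun k => ((ratr P)^-1 + (v k)^-1)^-1)) => //.
  + by move=> k /=; rewrite ?pq_n ?pq_m ?pq_p ?pq_P //; lra.
  + by move=> k; have [] := v_small k.
  + move=> k; apply/esym; apply: cf_block_neg => //; rewrite ?ne_ge2 ?m_ge2 //.
      by have [] := v_small k.+1.
    by rewrite vS invrN mulrN rmorphN /= yE //.
  + by rewrite ratioE invrK add_inv_int.
- have [P2 m2 n1 n_ge] := setup m1 ne1 p1.
  have [|||v [ratioE vS v_bound]] := @phi_ratio_tails R P m' n' d P2 d_neq0.
  1-3: by rewrite ?normrN !ger0_norm //; lra.
  have v_small k := tails_gt0 (ratr_ge2 R P2) (v_bound k).
  apply: (@cf_blocks_value_complex _ _ _ (fun k => (1 - (ratr P)^-1 + (v k)^-1)^-1)) => //.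
  + by move=> k /=; rewrite ?pq_n ?pq_m ?pq_p ?pq_P //; lra.
  + by move=> k; have [] := v_small k.
  + move=> k; apply/esym; apply: cf_block_shifted => //; rewrite ?ne_ge2 ?m_ge2 //.
      by have [] := v_small k.+1.
    by rewrite vS yE //.
  + by rewrite ratioE invrK sub_inv_int.
(* With -m in place of m the odd powers of m change sign, hence the two kinds of
   half-blocks. *)
- have [P2 m2 n1 n_ge] := setup m1 ne1 (lt_trans (ltr1n _ 2) p1).
  have P3 : 3 <= P by rewrite -[3]/(3%:~R) ler_int; lia.
  have [|||v [ratioE vS v_bound]] := @phi_ratio_tails R P (- m') n' d P2 d_neq0.
  1-3: by rewrite ?normrN !ger0_norm //; lra.
  have v_small k := tails_gt0 (ratr_ge2 R P2) (v_bound k).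
  rewrite mulNr -mulrN mulNr -mulrN -invrN -[- (m' * n')]mulNr ratioE.
  apply: (@cf_blocks_value_complex _ _ _
    (fun k => ((ratr P)^-1 + (v (2 * k)%N)^-1)^-1)) => //.
  + by move=> k; rewrite k_odd k_even /= ?pq_n ?pq_m ?pq_p ?pq_P //; lra.
  + by move=> k; have [] := v_small (2 * k)%N.
  + move=> k; rewrite k_odd k_even (cf_fold_cat [:: _; _; _; _; _]).
    have v1 : v (2 * k).+1 = ratr P ^+ 2 * ratr (n' ^+ (2 * k).+2 / e) +
        (ratr (m' ^+ (2 * k).+2) + (v (2 * k).+2)^-1)^-1.
      by rewrite vS exprN_even yE.
    have v0 : v (2 * k)%N = ratr P ^+ 2 * ratr (n' ^+ (2 * k).+1 / e) +
        (- ratr (m' ^+ (2 * k).+1) + (v (2 * k).+1)^-1)^-1.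
      by rewrite vS exprN_odd rmorphN /= yE.
    rewrite (cf_block_after_neg _ _ _ _ v1) ?ne_ge2 ?m_ge2 //; last first.
      by have [] := v_small (2 * k).+2.
    rewrite (cf_block_before_neg _ _ _ _ v0) ?ne_ge2 ?m_ge2 //.
    by have [] := v_small (2 * k).+1.
  + by rewrite muln0 invrK add_inv_int.
(* With -n in place of n the odd powers of n change sign: the half-blocks are
   those of the second and of the first case in turn. *)
- have [P2 m2 n1 n_ge] := setup m1 ne1 (lt_trans (ltr1n _ 2) p1).
  have P3 : 3 <= P by rewrite -[3]/(3%:~R) ler_int; lia.
  have [|||v [ratioE vS v_bound]] := @phi_ratio_tails R P m' (- n') d P2 d_neq0.
  1-3: by rewrite ?normrN !ger0_norm //; lra.
  have v_small k := tails_gt0 (ratr_ge2 R P2) (v_bound k).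
  rewrite mulNr -mulrN -invrN -[- (m' * n')]mulrN mulNr -mulrN -invrN ratioE.
  apply: (@cf_blocks_value_complex _ _ _
    (fun k => ((ratr P)^-1 + (v (2 * k)%N)^-1)^-1)) => //.
  + by move=> k; rewrite k_odd k_even /= ?pq_n ?pq_m ?pq_p ?pq_P //; lra.
  + by move=> k; have [] := v_small (2 * k)%N.
  + move=> k; rewrite k_odd k_even (cf_fold_cat [:: _; _; _; _; _; _]).
    have v1 : v (2 * k).+1 = ratr P ^+ 2 * ratr (n' ^+ (2 * k).+2 / e) +
        (ratr (m' ^+ (2 * k).+2) + (v (2 * k).+2)^-1)^-1.
      by rewrite vS exprN_even yE.
    have v0 : v (2 * k)%N = - (ratr P ^+ 2 * ratr (n' ^+ (2 * k).+1 / e)) +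
        (ratr (m' ^+ (2 * k).+1) + (v (2 * k).+1)^-1)^-1.
      by rewrite vS exprN_odd mulNr rmorphN /= yE.
    rewrite (cf_block_pos _ _ _ _ v1) ?ne_ge2 ?m_ge2 //; last first.
      by have [] := v_small (2 * k).+2.
    rewrite (cf_block_neg _ _ _ _ v0) ?ne_ge2 ?m_ge2 //.
    by have [] := v_small (2 * k).+1.
  + by rewrite muln0 invrK add_inv_int.
Qed.
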